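(* (EFO Model Existence.) Every evident EFO branch has a standard model. Every EFO-complete evident EFO branch has a standard model $\mathcal{I}$ in which $\mathcal{I}\alpha$ is countable for every sort $\alpha$. Every finite evident EFO branch has a standard model $\mathcal{I}$ in which $\mathcal{I}\sigma$ is finite for every type $\sigma$.
   Context: Types: a countable set of base types including a distinguished $o$; other base types are sorts ($\alpha$). Types: base types and $\sigma\tau$ (functions from $\sigma$ to $\tau$; $\sigma\tau\mu=\sigma(\tau\mu)$). Countably many names with unique types, infinitely many per type. Terms: names; $st:\mu$ for $s:\tau\mu,t:\tau$; $\lambda x.t:\sigma\tau$ for a name $x:\sigma$, $t:\tau$. $\mathrm{Wff}_\sigma$: terms of type $\sigma$. Logical constants: $\neg:oo$, $\to:ooo$, $=_\sigma:\sigma\sigma o$ for every type $\sigma$, and $\forall_\alpha:(\alpha o)o$ for every sort $\alpha$; all other names are variables. Formulas: terms of type $o$; $s=_\sigma t$ is $(=_\sigma s)t$, $s\neq_\sigma t$ is $\neg(s=_\sigma t)$, $s\to t$ is $(\to s)t$. A term is EFO if the only logical constants occurring in it are $\neg$, $\to$, $=_\alpha$ and $\forall_\alpha$ ($\alpha$ sorts); $\mathrm{EFO}_\sigma$ is the set of EFO terms of type $\sigma$. A formula is quasi-EFO if it is EFO or of the form $s\neq_\sigma t$ with $s,t$ EFO. Semantics: a frame $\mathcal{D}$ maps types to nonempty sets with $\mathcal{D}(\sigma\tau)\subseteq(\mathcal{D}\sigma\to\mathcal{D}\tau)$; it is standard if equality holds for all $\sigma,\tau$. An assignment $\mathcal{I}$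 into $\mathcal{D}$ extends $\mathcal{D}$ and maps names $x:\sigma$ into $\mathcal{D}\sigma$; $\mathcal{I}^x_a$ is the update. Partial evaluation: $\hat{\mathcal{I}}x=\mathcal{I}x$; $\hat{\mathcal{I}}(st)=(\hat{\mathcal{I}}s)(\hat{\mathcal{I}}t)$ when defined; $\hat{\mathcal{I}}(\lambda x.s)=f$ if $\lambda x.s:\sigma\tau$, $f\in\mathcal{D}(\sigma\tau)$ and $\widehat{\mathcal{I}^x_a}s=fa$ for all $a\in\mathcal{D}\sigma$. Interpretation: assignment with total evaluation. Logical: $\mathcal{I}o=\{0,1\}$, $\mathcal{I}(\neg)$ negation, $\mathcal{I}(\to)$ implication, $\mathcal{I}(=_\sigma)$ identity, $\mathcal{I}(\forall_\alpha)f=1$ iff $f$ is the constant function $1$. A standard model of a set of formulas is a logical assignment into a standard frame evaluating each of them to $1$. Normalization: fixed type-preserving total $[\cdot]$; $s$ normal iff $[s]=s$; (N1) $[[s]]=[s]$; (N2) $[[s]t]=[st]$; (N3) $[ys_1\dots s_n]=y[s_1]\dots[s_n]$ for a name $y$, $n\ge0$, $ys_1\dots s_n$ of base type; (N4) $\hat{\mathcal{I}}[s]=\hat{\mathcal{I}}s$ for every interpretation. Substitutions: type-preserving partial functions $\theta$ from names to terms ($\theta^x_s$ update), each extending to a type-preserving total $\hat\theta$ with (S1) $\hat\theta x=\theta x$ if $x\in\mathrm{Dom}\theta$, else $x$; (S2) $\hat\theta(st)=(\hat\theta s)(\hat\theta t)$; (S3) $[(\hat\theta(\lambda x.s))t]=[\widehat{\theta^x_t}s]$;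 (S4) $[\hat\emptyset s]=[s]$. An EFO branch is a set of normal quasi-EFO formulas. A term $u\in\mathrm{Wff}_\alpha$ is $\alpha$-discriminating in $E$ if $u\neq_\alpha t\in E$ or $t\neq_\alpha u\in E$ for some $t$. An EFO branch $E$ is evident if ($x$ ranges over variables): (DN) $\neg\neg s\in E\Rightarrow s\in E$; (BQ) $s=_ot\in E\Rightarrow$ ($s,t\in E$ or $\neg s,\neg t\in E$); (BE) $s\neq_ot\in E\Rightarrow$ ($s,\neg t\in E$ or $\neg s,t\in E$); (FQ) $s=_{\sigma\tau}t\in E\Rightarrow[su]=[tu]\in E$ for all normal $u:\sigma$; (FE) $s\neq_{\sigma\tau}t\in E\Rightarrow[sx]\neq[tx]\in E$ for some variable $x$; (Mat) $xs_1\dots s_n,\neg xt_1\dots t_n\in E\Rightarrow n\ge1$ and $s_i\neq t_i\in E$ for some $i$; (Dec) $xs_1\dots s_n\neq_\alpha xt_1\dots t_n\in E\Rightarrow n\ge 1$ and $s_i\neq t_i\in E$ for some $i$; (Con) $s=_\alpha t,u\neq_\alpha v\in E\Rightarrow$ ($s\neq u,t\neq u\in E$) or ($s\neq v,t\neq v\in E$); (Imp) $s\to t\in E\Rightarrow\neg s\in E$ or $t\in E$; (ImpN) $\neg(s\to t)\in E\Rightarrow s,\neg t\in E$; (All) $\forall_\alpha s\in E\Rightarrow[su]\in E$ for every $\alpha$-discriminating $u$ in $E$; (All') $\forall_\alpha s\in E\Rightarrow[su]\in E$ for some normal EFO term $u:\alpha$; (AllN) $\neg\forall_\alpha s\in E\Rightarrow\neg[sx]\in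 E$ for some variable $x$. $E$ is EFO-complete if for every normal $s\in\mathrm{EFO}_o$, $s\in E$ or $\neg s\in E$. *)

(* Defs.v *)
From mathcomp Require Import all_boot.
From Stdlib Require List.

Set Implicit Arguments.
Unset Strict Implicit.
Unset Printing Implicit Defensive.

(* ---------- Types ---------------------------------------------------------
   Base types: the distinguished type o (TO) and the sorts TS a, a : S.
   A countable set of base types with a distinguished element o is, up to
   renaming, exactly  option S  with S countable; so we parameterise by a
   countType S of sorts.                                                    *)
Inductive ty (S : Type) : Type :=
| TO : ty S
| TS : S -> ty S
| TArr : ty S -> ty S -> ty S.
Arguments TO {S}.

Definition is_base (S : Type) (t : ty S) : Prop :=
  match t with TArr _ _ => False | _ => True end.

Definition S_eq_dec (S : countType) (a b : S) : {a = b} + {a <> b}.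
Proof. case: (a =P b) => h; [left|right]; exact h. Defined.

Definition ty_eq_dec (S : countType) (a b : ty S) : {a = b} + {a <> b}.
Proof. decide equality; apply: S_eq_dec. Defined.

Inductive name (S : Type) : Type :=
| NNeg : name S
| NImp : name S
| NEq : ty S -> name S
| NAll : S -> name S
| NVar : ty S -> nat -> name S.
Arguments NNeg {S}.
Arguments NImp {S}.

Definition nty (S : Type) (x : name S) : ty S :=
  match x with
  | NNeg => TArr TO TO
  | NImp => TArr TO (TArr TO TO)
  | NEq s => TArr s (TArr s TO)
  | NAll a => TArr (TArr (TS a) TO) TO
  | NVar s _ => s
  end.

Definition name_eq_dec (S : countType) (x y : name S) : {x = y} + {x <> y}.
Proof.
decide equality; first [apply: ty_eq_dec | apply: PeanoNat.Nat.eq_dec | apply: S_eq_dec].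
Defined.

Inductive tm (S : Type) : Type :=
| N : name S -> tm S
| App : tm S -> tm S -> tm S
| Lam : name S -> tm S -> tm S.

Fixpoint typeof (S : countType) (t : tm S) : option (ty S) :=
  match t with
  | N x => Some (nty x)
  | App s u =>
      match typeof s, typeof u with
      | Some (TArr a b), Some c => if ty_eq_dec a c then Some b else None
      | _, _ => None
      end
  | Lam x s => match typeof s with Some b => Some (TArr (nty x) b) | None => None end
  end.

Definition wff (S : countType) (s : ty S) (t : tm S) : Prop := typeof t = Some s.

Definition apps (S : Type) (h : tm S) (ss : seq (tm S)) : tm S :=
  foldl (@App S) h ss.

Definition neg (S : Type) (s : tm S) : tm S := App (N NNeg) s.
Definition imp (S : Type) (s t : tm S) : tm S := App (App (N NImp) s) t.
Definition teq (S : Type) (a : ty S) (s t : tm S) : tm S := App (App (N (NEq a)) s) t.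
Definition tneq (S : Type) (a : ty S) (s t : tm S) : tm S := neg (teq a s t).
Definition tall (S : Type) (a : S) (s : tm S) : tm S := App (N (NAll a)) s.

(* ---------- Semantics ----------------------------------------------------
   A frame: nonempty carriers for every type, and for function types an
   (extensional) application, i.e. D(st) is (isomorphic to) a subset of
   D s -> D t.  Standard: every function D s -> D t is represented.        *)
Record frame (S : Type) : Type := Frame {
  dom : ty S -> Type;
  ap : forall a b : ty S, dom (TArr a b) -> dom a -> dom b;
  ap_ext : forall a b (f g : dom (TArr a b)), (forall v, ap f v = ap g v) -> f = g;
  dom_ne : forall a, inhabited (dom a)
}.
Arguments ap {S} f {a b} : rename.

Definition standard (S : Type) (F : frame S) : Prop :=
  forall a b (h : dom F a -> dom F b), exists f : dom F (TArr a b), forall v, ap F f v = h v.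

Definition assignment (S : Type) (F : frame S) : Type := forall x : name S, dom F (nty x).

Definition upd (S : countType) (F : frame S) (I : assignment F) (x : name S)
  (v : dom F (nty x)) : assignment F :=
  fun y => match name_eq_dec x y with
           | left e => eq_rect x (fun z => dom F (nty z)) v y e
           | right _ => I y
           end.
Arguments upd {S F} I x v.

(* Partial evaluation, as a (functional) relation:  Ev I t (s; v)  means
   \hat I t is defined and equals v \in D s.                                *)
Inductive Ev (S : countType) (F : frame S) :
    assignment F -> tm S -> {a : ty S & dom F a} -> Prop :=
| EvN : forall I x, Ev I (N x) (existT _ (nty x) (I x))
| EvApp : forall I s t a b (f : dom F (TArr a b)) (v : dom F a),
    Ev I s (existT _ (TArr a b) f) -> Ev I t (existT _ a v) ->
    Ev I (App s t) (existT _ b (ap F f v))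
| EvLam : forall I x s b (f : dom F (TArr (nty x) b)),
    (forall v : dom F (nty x), Ev (upd I x v) s (existT _ b (ap F f v))) ->
    Ev I (Lam x s) (existT _ (TArr (nty x) b) f).

Definition interpretation (S : countType) (F : frame S) (I : assignment F) : Prop :=
  forall t a, wff a t -> exists v, Ev I t (existT _ a v).

(* Logical assignment; tv identifies D o with {0,1} = bool (true = 1). *)
Definition logical (S : countType) (F : frame S) (I : assignment F)
  (tv : dom F TO -> bool) : Prop :=
  [/\ bijective tv,
      (forall p, tv (@ap _ F TO TO (I NNeg) p) = ~~ tv p),
      (forall p q, tv (@ap _ F TO TO (@ap _ F TO (TArr TO TO) (I NImp) p) q) = (tv p ==> tv q)),
      (forall (a : ty S) (u w : dom F a),
          tv (@ap _ F a TO (@ap _ F a (TArr a TO) (I (NEq a)) u) w) = true <-> u = w)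
    & (forall (a : S) (f : dom F (TArr (TS a) TO)),
          tv (@ap _ F (TArr (TS a) TO) TO (I (NAll a)) f) = true <->
          (forall u, tv (ap F f u) = true))].

Definition model (S : countType) (F : frame S) (I : assignment F) (E : tm S -> Prop) : Prop :=
  exists tv, logical I tv /\
    forall s, E s -> exists v, Ev I s (existT _ TO v) /\ tv v = true.

Definition countable_type (T : Type) : Prop := exists f : T -> nat, injective f.
Definition finite_type (T : Type) : Prop := exists l : list T, forall x, List.In x l.
Definition finite_set (T : Type) (E : T -> Prop) : Prop :=
  exists l : list T, forall x, E x <-> List.In x l.

Definition subst_ok (S : countType) (th : name S -> option (tm S)) : Prop :=
  forall x t, th x = Some t -> wff (nty x) t.

Definition upd_sub (S : countType) (th : name S -> option (tm S)) (x : name S) (t : tm S) :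
  name S -> option (tm S) :=
  fun y => if name_eq_dec x y then Some t else th y.

Definition normalization_ok (S : countType) (norm : tm S -> tm S)
  (subst : (name S -> option (tm S)) -> tm S -> tm S) : Prop :=
      (forall t a, wff a t -> wff a (norm t)) /\
      (* N1 *) (forall t a, wff a t -> norm (norm t) = norm t) /\
      (* N2 *) (forall s t a, wff a (App s t) -> norm (App (norm s) t) = norm (App s t)) /\
      (* N3 *) (forall y ss b, wff b (apps (N y) ss) -> is_base b ->
                  norm (apps (N y) ss) = apps (N y) (map norm ss)) /\
      (* N4 *) (forall (F : frame S) (I : assignment F), interpretation I ->
                  forall t a v, wff a t -> (Ev I (norm t) v <-> Ev I t v)) /\
      (forall th, subst_ok th -> forall t a, wff a t -> wff a (subst th t)) /\
      (* S1 *) (forall th, subst_ok th -> forall x,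
                  subst th (N x) = match th x with Some t => t | None => N x end) /\
      (* S2 *) (forall th, subst_ok th -> forall s t a, wff a (App s t) ->
                  subst th (App s t) = App (subst th s) (subst th t)) /\
      (* S3 *) (forall th, subst_ok th -> forall x s t a b,
                  wff (TArr a b) (Lam x s) -> wff a t ->
                  norm (App (subst th (Lam x s)) t) = norm (subst (upd_sub th x t) s))
    /\ (* S4 *) (forall t a, wff a t -> norm (subst (fun _ => None) t) = norm t).

Fixpoint names_of (S : Type) (t : tm S) : list (name S) :=
  match t with
  | N x => x :: nil
  | App s u => names_of s ++ names_of u
  | Lam x s => x :: names_of s
  end.

Definition efo_name (S : Type) (x : name S) : bool :=
  match x with
  | NEq (TS _) => true
  | NEq _ => false
  | _ => true
  end.

Definition EFO (S : Type) (t : tm S) : Prop := forall x, List.In x (names_of t) -> efo_name x.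

Definition quasi_EFO (S : Type) (s : tm S) : Prop :=
  EFO s \/ exists a u w, s = tneq a u w /\ EFO u /\ EFO w.

Definition normal (S : Type) (norm : tm S -> tm S) (s : tm S) : Prop := norm s = s.

Definition efo_branch (S : countType) (norm : tm S -> tm S) (E : tm S -> Prop) : Prop :=
  forall s, E s -> [/\ wff TO s, normal norm s & quasi_EFO s].

Definition discriminating (S : countType) (E : tm S -> Prop) (a : S) (u : tm S) : Prop :=
  wff (TS a) u /\ exists t, E (tneq (TS a) u t) \/ E (tneq (TS a) t u).

Definition evident (S : countType) (norm : tm S -> tm S) (E : tm S -> Prop) : Prop :=
  (* DN *) (forall s, E (neg (neg s)) -> E s) /\
      (* BQ *) (forall s t, E (teq TO s t) -> (E s /\ E t) \/ (E (neg s) /\ E (neg t))) /\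
      (* BE *) (forall s t, E (tneq TO s t) -> (E s /\ E (neg t)) \/ (E (neg s) /\ E t)) /\
      (* FQ *) (forall a b s t, E (teq (TArr a b) s t) ->
                  forall u, wff a u -> normal norm u ->
                  E (teq b (norm (App s u)) (norm (App t u)))) /\
      (* FE *) (forall a b s t, E (tneq (TArr a b) s t) ->
                  exists n, E (tneq b (norm (App s (N (NVar a n))))
                                      (norm (App t (N (NVar a n)))))) /\
      (* Mat *) (forall a n ss ts, E (apps (N (NVar a n)) ss) ->
                   E (neg (apps (N (NVar a n)) ts)) ->
                   exists i, (i < size ss)%N /\
                     exists c, E (tneq c (nth (N NNeg) ss i) (nth (N NNeg) ts i))) /\
      (* Dec *) (forall (al : S) a n ss ts,
                   E (tneq (TS al) (apps (N (NVar a n)) ss) (apps (N (NVar a n)) ts)) ->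
                   exists i, (i < size ss)%N /\
                     exists c, E (tneq c (nth (N NNeg) ss i) (nth (N NNeg) ts i))) /\
      (* Con *) (forall (al : S) s t u v, E (teq (TS al) s t) -> E (tneq (TS al) u v) ->
                   (E (tneq (TS al) s u) /\ E (tneq (TS al) t u)) \/
                   (E (tneq (TS al) s v) /\ E (tneq (TS al) t v))) /\
      (* Imp *) (forall s t, E (imp s t) -> E (neg s) \/ E t) /\
      (* ImpN *) (forall s t, E (neg (imp s t)) -> E s /\ E (neg t)) /\
      (* All *) (forall al s, E (tall al s) ->
                   forall u, discriminating E al u -> E (norm (App s u))) /\
      (* All' *) (forall al s, E (tall al s) ->
                    exists u, [/\ wff (TS al) u, normal norm u, EFO u & E (norm (App s u))])
    /\ (* AllN *) (forall al s, E (neg (tall al s)) ->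
                    exists n, E (neg (norm (App s (N (NVar (TS al) n)))))).

Definition efo_complete (S : countType) (norm : tm S -> tm S) (E : tm S -> Prop) : Prop :=
  forall s, wff TO s -> normal norm s -> EFO s -> E s \/ E (neg s).

(* Main.v *)
(* A sort is interpreted by the discriminants of the branch: the maximal sets of
   discriminating terms no two of which are separated by a disequation of the
   branch.  With o interpreted by the booleans and all functions at function
   types, a logical relation "the term s possibly has the value v" says at base
   types that the branch does not refute that s is v.  Two terms with a common
   possible value are never separated by a disequation, and every variable and
   every EFO logical constant has a possible value; hence so does every EFO term,
   namely its denotation, and the branch is satisfied.

   The quantifier is the delicate constant.  If the empty set is a discriminant,
   the instances at discriminating terms say nothing about it, so one must know
   that then there are no discriminating terms at all, i.e. that u <> u is never
   in the branch for an EFO term u.  This comes from a first logical relation,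
   between terms only (compatibility), under which every EFO term is related
   to itself.

   In an EFO-complete branch two discriminants with a common element coincide,
   so a choice of an element embeds them into the countable set of terms.  A
   finite branch has finitely many discriminating terms, hence finitely many
   discriminants. *)

Require Import Defs.
From mathcomp Require Import all_boot.
From mathcomp Require Import boolp classical_sets.
From Stdlib Require List.

Set Implicit Arguments.
Unset Strict Implicit.
Unset Printing Implicit Defensive.

(** * Typing and EFO subterms *)

Section Typing.
Context (S : countType).
Implicit Types (a b c : ty S) (s t u w : tm S) (x : name S).

Lemma wff_uniq a b s : wff a s -> wff b s -> a = b.
Proof. by rewrite /wff => -> []. Qed.

Lemma wff_app a b s t : wff (TArr a b) s -> wff a t -> wff b (App s t).
Proof. by rewrite /wff /= => -> ->; case: ty_eq_dec. Qed.

Lemma wff_appE b s t :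
  wff b (App s t) -> exists2 a, wff (TArr a b) s & wff a t.
Proof.
rewrite /wff /=; case Es: (typeof s) => [[|//|a c]|] //.
case Et: (typeof t) => [d|] //.
by case: ty_eq_dec => [e [<-]|] //; exists a => //; rewrite e.
Qed.

Lemma wff_lamE c x s :
  wff c (Lam x s) -> exists2 b, c = TArr (nty x) b & wff b s.
Proof. by rewrite /wff /=; case: (typeof s) => // b [<-]; exists b. Qed.

Lemma wff_neg s : wff TO s -> wff TO (neg s).
Proof. exact: wff_app. Qed.

Lemma wff_imp s t : wff TO s -> wff TO t -> wff TO (imp s t).
Proof. by move=> ws; apply: wff_app; apply: wff_app ws. Qed.

Lemma wff_teq a s t : wff a s -> wff a t -> wff TO (teq a s t).
Proof. by move=> ws; apply: wff_app; apply: wff_app ws. Qed.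

Lemma wff_tall (al : S) s : wff (TArr (TS al) TO) s -> wff TO (tall al s).
Proof. exact: wff_app. Qed.

Lemma wff_tneqE a s t : wff TO (tneq a s t) -> wff a s /\ wff a t.
Proof.
case/wff_appE => b [<-] /wff_appE[c] /wff_appE[d [<- <-]] ws wt.
by split.
Qed.

Lemma apps_rcons s ts u : apps s (rcons ts u) = App (apps s ts) u.
Proof. by rewrite /apps foldl_rcons. Qed.

Lemma EFO_app s t : EFO (App s t) -> EFO s /\ EFO t.
Proof.
by move=> h; split=> x hx; apply: h; apply/List.in_or_app; [left|right].
Qed.

Lemma EFO_teq (al : S) s t : EFO s -> EFO t -> EFO (teq (TS al) s t).
Proof.
move=> es et x [<- //|hx].
by have [/es|/et] := List.in_app_or (names_of s) (names_of t) x hx.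
Qed.

Lemma EFO_lam x s : EFO (Lam x s) -> EFO s.
Proof. by move=> h y hy; apply: h; right. Qed.

Lemma EFO_name x : EFO (N x) -> efo_name x.
Proof. by move=> h; apply: h; left. Qed.

Lemma quasi_EFO_tneq a s t : quasi_EFO (tneq a s t) -> EFO s /\ EFO t.
Proof.
case=> [h|[b [u [w [[_ -> ->] []]]]]] //.
have [_ /EFO_app[/EFO_app[_ ?] ?]] := EFO_app h; by split.
Qed.

End Typing.

Section EvidentBranch.
Context (S : countType) (norm : tm S -> tm S)
  (subst : (name S -> option (tm S)) -> tm S -> tm S) (E : tm S -> Prop).
Hypothesis norm_subst : normalization_ok norm subst.
Hypothesis EB : efo_branch norm E.
Hypothesis EE : evident norm E.
Implicit Types (a b c : ty S) (al : S) (s t u w : tm S) (x : name S).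
Implicit Types (ss ts : seq (tm S)) (th : name S -> option (tm S)).

(** * Normalization and substitution *)

Lemma wff_norm a s : wff a s -> wff a (norm s).
Proof. by case: norm_subst => h _; apply: h. Qed.

Lemma norm_app a b s t : wff (TArr a b) s -> wff a t ->
  norm (App (norm s) t) = norm (App s t).
Proof. by case: norm_subst => _ [_ [h _]] ws /(wff_app ws)/h. Qed.

Lemma norm_apps b x ss : wff b (apps (N x) ss) -> is_base b ->
  norm (apps (N x) ss) = apps (N x) (map norm ss).
Proof. by case: norm_subst => _ [_ [_ [h _]]]; apply: h. Qed.

Lemma wff_subst th a s : subst_ok th -> wff a s -> wff a (subst th s).
Proof.
by case: norm_subst => _ [_ [_ [_ [_ [h _]]]]] hth; apply: h.
Qed.

Lemma subst_name th x : subst_ok th ->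
  subst th (N x) = if th x is Some t then t else N x.
Proof.
by case: norm_subst => _ [_ [_ [_ [_ [_ [h _]]]]]] hth; apply: h.
Qed.

Lemma subst_app th a s t : subst_ok th -> wff a (App s t) ->
  subst th (App s t) = App (subst th s) (subst th t).
Proof.
by case: norm_subst => _ [_ [_ [_ [_ [_ [_ [h _]]]]]]] hth; apply: h.
Qed.

Lemma norm_subst_lam th x s t b : subst_ok th ->
    wff b s -> wff (nty x) t ->
  norm (App (subst th (Lam x s)) t) = norm (subst (upd_sub th x t) s).
Proof.
case: norm_subst => _ [_ [_ [_ [_ [_ [_ [_ [h _]]]]]]]] hth ws.
by apply: (h _ hth _ _ _ _ b); rewrite /wff /= ws.
Qed.

Lemma norm_subst_id a s : wff a s -> norm (subst (fun=> None) s) = norm s.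
Proof.
by case: norm_subst => _ [_ [_ [_ [_ [_ [_ [_ [_ h]]]]]]]]; apply: h.
Qed.

Lemma subst_ok_id : subst_ok (fun _ : name S => None).
Proof. by []. Qed.

Lemma subst_ok_upd th x t :
  subst_ok th -> wff (nty x) t -> subst_ok (upd_sub th x t).
Proof.
move=> hth wt y u; rewrite /upd_sub; case: name_eq_dec => [exy|_] /=; last exact: hth.
by case=> <-; rewrite -exy.
Qed.

Lemma norm_neg s : wff TO s -> norm (neg s) = neg (norm s).
Proof. by move=> /wff_neg w; apply: (@norm_apps TO NNeg [:: s]). Qed.

Lemma norm_imp s t : wff TO s -> wff TO t ->
  norm (imp s t) = imp (norm s) (norm t).
Proof.
by move=> ws wt; apply: (@norm_apps TO NImp [:: s; t]) => //; apply: wff_imp.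
Qed.

Lemma norm_teq a s t : wff a s -> wff a t ->
  norm (teq a s t) = teq a (norm s) (norm t).
Proof.
by move=> ws wt; apply: (@norm_apps TO (NEq a) [:: s; t]) => //; apply: wff_teq.
Qed.

Lemma norm_tneq a s t : wff a s -> wff a t ->
  norm (tneq a s t) = tneq a (norm s) (norm t).
Proof. by move=> ws wt; rewrite norm_neg ?norm_teq //; apply: wff_teq. Qed.

Lemma norm_tall al s : wff (TArr (TS al) TO) s ->
  norm (tall al s) = tall al (norm s).
Proof.
by move=> ws; apply: (@norm_apps TO (NAll al) [:: s]) => //; apply: wff_tall.
Qed.

(** * Evidence conditions *)

Lemma evident_DN s : E (neg (neg s)) -> E s.
Proof. by case: EE => h _; apply: h. Qed.

Lemma evident_BE s t :
  E (tneq TO s t) -> (E s /\ E (neg t)) \/ (E (neg s) /\ E t).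
Proof. by case: EE => _ [_ [h _]]; apply: h. Qed.

Lemma evident_FE a b s t : E (tneq (TArr a b) s t) ->
  exists n, E (tneq b (norm (App s (N (NVar a n))))
                      (norm (App t (N (NVar a n))))).
Proof. by case: EE => _ [_ [_ [_ [h _]]]]; apply: h. Qed.

Lemma evident_Mat a n ss ts :
  E (apps (N (NVar a n)) ss) -> E (neg (apps (N (NVar a n)) ts)) ->
  exists i, (i < size ss)%N /\
    exists c, E (tneq c (nth (N NNeg) ss i) (nth (N NNeg) ts i)).
Proof. by case: EE => _ [_ [_ [_ [_ [h _]]]]]; apply: h. Qed.

Lemma evident_Dec al a n ss ts :
  E (tneq (TS al) (apps (N (NVar a n)) ss) (apps (N (NVar a n)) ts)) ->
  exists i, (i < size ss)%N /\
    exists c, E (tneq c (nth (N NNeg) ss i) (nth (N NNeg) ts i)).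
Proof. by case: EE => _ [_ [_ [_ [_ [_ [h _]]]]]]; apply: h. Qed.

Lemma evident_Con al s t u w : E (teq (TS al) s t) -> E (tneq (TS al) u w) ->
  (E (tneq (TS al) s u) /\ E (tneq (TS al) t u)) \/
  (E (tneq (TS al) s w) /\ E (tneq (TS al) t w)).
Proof. by case: EE => _ [_ [_ [_ [_ [_ [_ [h _]]]]]]]; apply: h. Qed.

Lemma evident_Imp s t : E (imp s t) -> E (neg s) \/ E t.
Proof. by case: EE => _ [_ [_ [_ [_ [_ [_ [_ [h _]]]]]]]]; apply: h. Qed.

Lemma evident_ImpN s t : E (neg (imp s t)) -> E s /\ E (neg t).
Proof. by case: EE => _ [_ [_ [_ [_ [_ [_ [_ [_ [h _]]]]]]]]]; apply: h. Qed.

Lemma evident_All al s u :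
  E (tall al s) -> discriminating E al u -> E (norm (App s u)).
Proof.
case: EE => _ [_ [_ [_ [_ [_ [_ [_ [_ [_ [h _]]]]]]]]]] Es.
exact: h Es _.
Qed.

Lemma evident_All' al s : E (tall al s) ->
  exists u, [/\ wff (TS al) u, normal norm u, EFO u & E (norm (App s u))].
Proof.
by case: EE => _ [_ [_ [_ [_ [_ [_ [_ [_ [_ [_ [h _]]]]]]]]]]]; apply: h.
Qed.

Lemma evident_AllN al s : E (neg (tall al s)) ->
  exists n, E (neg (norm (App s (N (NVar (TS al) n))))).
Proof.
by case: EE => _ [_ [_ [_ [_ [_ [_ [_ [_ [_ [_ [_ h]]]]]]]]]]]; apply: h.
Qed.

(** * Disequations of the branch *)

Lemma branch_tneqE a s t :
  E (tneq a s t) -> [/\ wff a s, wff a t, EFO s & EFO t].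
Proof. by case/EB => /wff_tneqE[? ?] _ /quasi_EFO_tneq[]. Qed.

Lemma discriminatingl al s t : E (tneq (TS al) s t) -> discriminating E al s.
Proof. by move=> Est; case/branch_tneqE: (Est); split=> //; exists t; left. Qed.

Lemma discriminatingr al s t : E (tneq (TS al) s t) -> discriminating E al t.
Proof. by move=> Est; case/branch_tneqE: (Est); split=> //; exists s; right. Qed.

Lemma discriminating_EFO al u : discriminating E al u -> EFO u.
Proof. by case=> _ [t [] /branch_tneqE[]]. Qed.

(* No disequation of the branch separates corresponding arguments, so neither
   (Mat) nor (Dec) applies to [x ss] and [x ts]. *)
Definition unseparated ss ts : Prop :=
  size ss = size ts /\ forall i, (i < size ss)%N -> forall c,
    ~ E (tneq c (norm (nth (N NNeg) ss i)) (norm (nth (N NNeg) ts i))).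

Lemma unseparated_rcons a ss ts s t : unseparated ss ts -> wff a s ->
    ~ E (tneq a (norm s) (norm t)) ->
  unseparated (rcons ss s) (rcons ts t).
Proof.
move=> [sz h] ws nE; split; rewrite ?size_rcons ?sz // => i.
rewrite ltnS !nth_rcons sz; case: (ltngtP i (size ts)) => [lt _||_ _] // c.
  by apply: h; rewrite sz.
by move=> Ec; case/branch_tneqE: (Ec) => /(wff_uniq (wff_norm ws)) ac; subst c.
Qed.

Lemma unseparated_Mat a n ss ts : unseparated ss ts ->
    wff TO (apps (N (NVar a n)) ss) -> wff TO (apps (N (NVar a n)) ts) ->
  ~ (E (norm (apps (N (NVar a n)) ss)) /\ E (neg (norm (apps (N (NVar a n)) ts)))).
Proof.
move=> [sz h] ws wt []; rewrite (norm_apps ws) // (norm_apps wt) // => Es Et.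
have [i []] := evident_Mat Es Et; rewrite size_map => lt [c].
by rewrite !(nth_map (N NNeg)) -?sz //; apply: h.
Qed.

Lemma unseparated_Dec al a n ss ts : unseparated ss ts ->
    wff (TS al) (apps (N (NVar a n)) ss) -> wff (TS al) (apps (N (NVar a n)) ts) ->
  ~ E (tneq (TS al) (norm (apps (N (NVar a n)) ss)) (norm (apps (N (NVar a n)) ts))).
Proof.
move=> [sz h] ws wt; rewrite (norm_apps ws) // (norm_apps wt) // => Est.
have [i []] := evident_Dec Est; rewrite size_map => lt [c].
by rewrite !(nth_map (N NNeg)) -?sz //; apply: h.
Qed.

(** * Compatibility of terms *)

(* [compat] need not be reflexive: reflexivity of EFO terms is the content of
   [compat_subst] below, and it is what excludes [u <> u] from the branch. *)
Fixpoint compat a : tm S -> tm S -> Prop :=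
  match a with
  | TO => fun s t => ~ (E (norm s) /\ E (neg (norm t))) /\
                     ~ (E (norm t) /\ E (neg (norm s)))
  | TS al => fun s t => ~ E (tneq (TS al) (norm s) (norm t)) /\
                        ~ E (tneq (TS al) (norm t) (norm s))
  | TArr a b => fun s t => forall u w, wff a u -> wff a w -> compat a u w ->
                  compat b (App s u) (App t w)
  end.

Lemma compat_sym a s t : compat a s t -> compat a t s.
Proof.
elim: a s t => [|al|a IHa b IHb] s t /=; try by case.
by move=> h u w wu ww /IHa uw; apply/IHb/h.
Qed.

Lemma compat_norm a s s' t t' : wff a s -> wff a s' -> wff a t -> wff a t' ->
  norm s = norm s' -> norm t = norm t' -> compat a s t -> compat a s' t'.
Proof.
elim: a s s' t t' => [|al|a IHa b IHb] s s' t t' ws ws' wt wt' es et /=.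
- by rewrite es et.
- by rewrite es et.
- move=> h u w wu ww /(h _ _ wu ww); apply: IHb; try exact: wff_app wu; try exact: wff_app ww.
    by rewrite -(norm_app ws wu) es (norm_app ws' wu).
  by rewrite -(norm_app wt ww) et (norm_app wt' ww).
Qed.

(** Simultaneous induction on the type. At a function type, the first half uses the second for the
    variable supplied by (FE), and the second uses the first to append compatible arguments. *)
Lemma compat_unseparated_var a :
  (forall s t, wff a s -> wff a t -> compat a s t -> ~ E (tneq a (norm s) (norm t))) /\
  (forall c n ss ts, wff a (apps (N (NVar c n)) ss) -> wff a (apps (N (NVar c n)) ts) ->
     unseparated ss ts -> unseparated ts ss ->
     compat a (apps (N (NVar c n)) ss) (apps (N (NVar c n)) ts)).
Proof.
elim: a => [|al|a [IHa1 IHa2] b [IHb1 IHb2]]; split=> /=.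
- by move=> s t _ _ [h1 h2] /evident_BE[/h1|[Es Et]] //; apply: h2.
- by move=> c n ss ts ws wt st ts'; split; apply: unseparated_Mat.
- by move=> s t _ _ [].
- by move=> c n ss ts ws wt st ts'; split; apply: unseparated_Dec.
- move=> s t ws wt st /evident_FE[n].
  have wn : wff a (N (NVar a n)) by [].
  rewrite (norm_app ws wn) (norm_app wt wn); apply: IHb1; try exact: wff_app wn.
  by apply: st => //; apply: (IHa2 a n [::] [::]).
- move=> c n ss ts ws wt st ts' u w wu ww uw; rewrite -!apps_rcons.
  apply: IHb2; rewrite ?apps_rcons; try exact: wff_app wu; try exact: wff_app ww.
    exact: unseparated_rcons st wu (IHa1 _ _ wu ww uw).
  exact: unseparated_rcons ts' ww (IHa1 _ _ ww wu (compat_sym uw)).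
Qed.

Lemma compat_var a n : compat a (N (NVar a n)) (N (NVar a n)).
Proof. by apply: (proj2 (compat_unseparated_var a) a n [::] [::]). Qed.

(** (AllN) supplies a variable for [t]. If it is discriminating, (All) instantiates [s] with it;
    otherwise it is compatible with every term of its sort, in particular with the one from
    (All'). *)
Lemma compat_all al s t : wff (TArr (TS al) TO) s -> wff (TArr (TS al) TO) t ->
    compat (TArr (TS al) TO) s t ->
  ~ (E (tall al (norm s)) /\ E (neg (tall al (norm t)))).
Proof.
move=> ws wt st [Es /evident_AllN[n]].
have wn : wff (TS al) (N (NVar (TS al) n)) by [].
have nn : norm (N (NVar (TS al) n)) = N (NVar (TS al) n).
  exact: (@norm_apps (TS al) (NVar (TS al) n) [::]).
rewrite (norm_app wt wn) => Et.
have [dn|ndn] := EM (discriminating E al (N (NVar (TS al) n))).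
  have := evident_All Es dn; rewrite (norm_app ws wn) => Esn.
  by case: (st _ _ wn wn (compat_var (TS al) n)) => -[].
have [u [wu _ _]] := evident_All' Es; rewrite (norm_app ws wu) => Esu.
have un : compat (TS al) u (N (NVar (TS al) n)).
  by split; rewrite nn => h; apply: ndn; [apply: discriminatingr h|apply: discriminatingl h].
by case: (st _ _ wu wn un) => -[].
Qed.

Lemma compat_name x : efo_name x -> compat (nty x) (N x) (N x).
Proof.
case: x => [|||al|a n] /=; last by move=> _; apply: compat_var.
- move=> _ s t ws wt [st ts]; rewrite !norm_neg //.
  by split=> -[? /evident_DN ?]; [apply: ts|apply: st].
- move=> _ s t ws wt [st ts] s' t' ws' wt' [st' ts']; rewrite !norm_imp //.
  by split=> -[/evident_Imp[?|?] /evident_ImpN[? ?]];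
    [apply: ts|apply: st'|apply: st|apply: ts'].
- case=> //= al _ s t ws wt [st ts] s' t' ws' wt' [st' ts']; rewrite !norm_teq //.
  by split=> -[h1 h2]; case: (evident_Con h1 h2) => -[].
- move=> _ s t ws wt st; rewrite !norm_tall //.
  by split; apply: compat_all => //; apply: compat_sym.
Qed.

(** The fundamental property of the logical relation. Two substitutions are needed because under an
    abstraction the bound name receives two compatible terms; (S3) absorbs them into the
    substitutions. *)
Lemma compat_subst a s th th' : wff a s -> EFO s -> subst_ok th -> subst_ok th' ->
    (forall x, efo_name x -> compat (nty x) (subst th (N x)) (subst th' (N x))) ->
  compat a (subst th s) (subst th' s).
Proof.
elim: s a th th' => [x|s IHs t IHt|x s IHs] a th th' ws es hth hth' h.
- by case: ws => <-; apply/h/EFO_name.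
- rewrite (subst_app hth ws) (subst_app hth' ws).
  have [b wfs wft] := wff_appE ws; have [es1 es2] := EFO_app es.
  have := IHs _ _ _ wfs es1 hth hth' h; apply; try exact: wff_subst.
  exact: IHt.
- have [b ea wb] := wff_lamE ws; subst a => u w wu ww uw.
  have ku := subst_ok_upd hth wu; have kw := subst_ok_upd hth' ww.
  apply: (@compat_norm _ (subst (upd_sub th x u) s) _ (subst (upd_sub th' x w) s)).
  + exact: wff_subst.
  + by apply: wff_app wu; apply: wff_subst.
  + exact: wff_subst.
  + by apply: wff_app ww; apply: wff_subst.
  + by rewrite (norm_subst_lam hth wb wu).
  + by rewrite (norm_subst_lam hth' wb ww).
  apply: IHs => //; first exact: EFO_lam es.
  move=> y ey; rewrite !subst_name // /upd_sub.
  case: name_eq_dec => [exy|_] /=; first by subst y.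
  by have := h y ey; rewrite !subst_name.
Qed.

(** By (S4), [u] may be replaced by its image under the empty substitution, which is compatible with
    itself. *)
Lemma EFO_irrefl al u : EFO u -> wff (TS al) u -> ~ E (tneq (TS al) (norm u) (norm u)).
Proof.
move=> eu wu; rewrite -(norm_subst_id wu).
suff [] : compat (TS al) (subst (fun=> None) u) (subst (fun=> None) u) by [].
apply: compat_subst => // x ex; rewrite subst_name //; exact: compat_name.
Qed.


(** * Discriminants and the standard frame *)

Definition unconflicted al (X : tm S -> Prop) : Prop :=
  (forall u, X u -> discriminating E al u) /\
  (forall u w, X u -> X w -> ~ E (tneq (TS al) u w)).

Definition discriminant al (X : tm S -> Prop) : Prop :=
  unconflicted al X /\
  forall Y, unconflicted al Y -> (forall u, X u -> Y u) -> forall u, Y u -> X u.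

Lemma discriminant_ext al X : unconflicted al X ->
  exists2 Y, discriminant al Y & forall u, X u -> Y u.
Proof.
move=> hX.
(* Zorn is applied to the sets whose union with [X] is unconflicted, so that the empty chain is
   covered too. *)
have [F hF totF|Z [hZ maxZ]] :=
    @Zorn_bigcup (tm S) (fun Z => unconflicted al (fun u => X u \/ Z u)).
  split=> [u [/(proj1 hX)//|[Z FZ Zu]]|u w].
    by apply: (proj1 (hF _ FZ)); right.
  move=> [Xu|[Z FZ Zu]] [Xw|[Z' FZ' Zw]]; first exact: (proj2 hX).
  - by apply: (proj2 (hF _ FZ')); [left|right].
  - by apply: (proj2 (hF _ FZ)); [right|left].
  - have [ZZ'|Z'Z] := totF _ _ FZ FZ'.
      by apply: (proj2 (hF _ FZ')); right=> //; apply: ZZ'.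
    by apply: (proj2 (hF _ FZ)); right=> //; apply: Z'Z.
exists (fun u => X u \/ Z u); last by left.
split=> // Y hY XZY u Yu; apply: contrapT => nXZu.
apply: (maxZ Y).
  split=> [w Zw|YZ]; first by apply: XZY; right.
  by apply: nXZu; right; apply: YZ.
suff -> : (fun w => X w \/ Y w) = Y by [].
by apply/predeqP => w; split=> [[Xw|//]|]; [apply: XZY; left|right].
Qed.

Fixpoint dvalue a : Type :=
  match a with
  | TO => bool
  | TS al => {X : tm S -> Prop | discriminant al X}
  | TArr a b => dvalue a -> dvalue b
  end.

Lemma dvalue_TS_ext al (X Y : dvalue (TS al)) :
  (forall u, sval X u -> sval Y u) -> X = Y.
Proof.
case: X Y => [X hX] [Y hY] /= XY; apply: eq_exist; apply/predeqP => u.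
by split; [exact: XY|exact: (proj2 hX _ (proj1 hY) XY)].
Qed.

Lemma dvalue_inhabited a : inhabited (dvalue a).
Proof.
elim: a => [|al|a _ b [v]] /=; [exact: (inhabits true)| |exact: (inhabits (fun=> v))].
have [|Y hY _] := @discriminant_ext al (fun=> False); first by split.
exact: (inhabits (exist _ Y hY)).
Qed.

Definition dframe : frame S :=
  @Frame S dvalue (fun a b f v => f v) (fun a b f g => @funext _ _ f g)
    dvalue_inhabited.

Lemma dframe_standard : standard dframe.
Proof. by move=> a b h; exists h. Qed.

(** * Possible values *)

(** At a sort, a term without discriminating normal form has every discriminant as a possible
    value. *)
Fixpoint possible a : tm S -> dvalue a -> Prop :=
  match a with
  | TO => fun s v => ~ E (if v then neg (norm s) else norm s)
  | TS al => fun s X => discriminating E al (norm s) -> sval X (norm s)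
  | TArr a b => fun s f =>
      forall t v, wff a t -> possible t v -> possible (App s t) (f v)
  end.

Lemma possible_norm a s s' (v : dvalue a) : wff a s -> wff a s' ->
  norm s = norm s' -> possible s v -> possible s' v.
Proof.
elim: a s s' v => [|al|a IHa b IHb] s s' v ws ws' es /=; try by rewrite es.
move=> h t y wt /(h _ _ wt); apply: IHb; try exact: wff_app wt.
by rewrite -(norm_app ws wt) es (norm_app ws' wt).
Qed.

(** Simultaneous induction on the type. A whole family [L] is needed: at a function type the value
    at [v] must serve all lists of [L] extended by any term with possible value [v], and the first
    half keeps these extensions unseparated. *)
Lemma possible_unseparated_var a :
  (forall s t (v : dvalue a), wff a s -> wff a t -> possible s v -> possible t v ->
     ~ E (tneq a (norm s) (norm t))) /\
  (forall c n (L : seq (tm S) -> Prop),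
     (forall ss, L ss -> wff a (apps (N (NVar c n)) ss)) ->
     (forall ss ts, L ss -> L ts -> unseparated ss ts) ->
     exists v : dvalue a, forall ss, L ss -> possible (apps (N (NVar c n)) ss) v).
Proof.
elim: a => [|al|a [IHa1 IHa2] b [IHb1 IHb2]]; split=> /=.
- by move=> s t [] _ _ nEs nEt /evident_BE[[? ?]|[? ?]].
- move=> c n L wL uL.
  (* The value is true iff the branch contains an instance; (Mat) then excludes all negated
     instances. *)
  have [[ss Lss Ess]|nE] := EM (exists2 ss, L ss & E (norm (apps (N (NVar c n)) ss))).
    exists true => ts Lts Ets.
    by apply: (unseparated_Mat (uL _ _ Lss Lts) (wL _ Lss) (wL _ Lts)).
  by exists false => ss Lss Ess; apply: nE; exists ss.
- move=> s t X _ _ hs ht Est.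
  have /hs Xs := discriminatingl Est; have /ht Xt := discriminatingr Est.
  exact: (proj2 (proj1 (svalP X)) _ _ Xs Xt Est).
- move=> c n L wL uL.
  (* By (Dec) the discriminating instances are unconflicted; a discriminant containing them is the
     value. *)
  have [|Y hY LY] := @discriminant_ext al (fun u => discriminating E al u /\
      exists2 ss, L ss & u = norm (apps (N (NVar c n)) ss)).
    split=> [u []//|_ _ [_ [ss Lss ->]] [_ [ts Lts ->]]].
    exact: (unseparated_Dec (uL _ _ Lss Lts) (wL _ Lss) (wL _ Lts)).
  by exists (exist _ Y hY) => ss Lss /= ds; apply: LY; split=> //; exists ss.
- move=> s t f ws wt hs ht /evident_FE[n].
  have wn : wff a (N (NVar a n)) by [].
  have [||v hv] := IHa2 a n (fun ss => ss = [::]).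
  + by move=> _ ->.
  + by move=> _ _ -> ->.
  rewrite (norm_app ws wn) (norm_app wt wn).
  have hn : possible (N (NVar a n)) v by apply: (hv [::]).
  by apply: (IHb1 _ _ (f v)); [exact: wff_app wn|exact: wff_app wn|exact: hs|exact: ht].
- move=> c n L wL uL.
  have /choice[f hf] : forall v : dvalue a, exists y : dvalue b,
      forall ss u, L ss -> wff a u -> possible u v ->
        possible (apps (N (NVar c n)) (rcons ss u)) y.
    move=> v.
    have [||y hy] := IHb2 c n
      (fun us => exists ss u, [/\ L ss, wff a u, possible u v & us = rcons ss u]).
    + by move=> _ [ss [u [Lss wu _ ->]]]; rewrite apps_rcons; apply: wff_app wu; apply: wL.
    + move=> _ _ [ss [u [Lss wu pu ->]]] [ts [w [Lts ww pw ->]]].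
      exact: (unseparated_rcons (uL _ _ Lss Lts) wu (IHa1 _ _ _ wu ww pu pw)).
    by exists y => ss u Lss wu pu; apply: hy; exists ss, u.
  by exists f => ss Lss t v wt pt; rewrite -apps_rcons; apply: hf.
Qed.

Lemma possible_var a n : exists v : dvalue a, possible (N (NVar a n)) v.
Proof.
have [||v hv] := proj2 (possible_unseparated_var a) a n (fun ss => ss = [::]).
- by move=> _ ->.
- by move=> _ _ -> ->.
by exists v; apply: (hv [::]).
Qed.

Lemma possible_tneq a s t (v : dvalue a) : wff a s -> wff a t ->
  possible s v -> possible t v -> ~ E (tneq a (norm s) (norm t)).
Proof. exact: (proj1 (possible_unseparated_var a)). Qed.

(** * The logical assignment and the EFO constants *)

Definition dassignment : assignment dframe := fun x =>
  match x return dvalue (nty x) with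
  | NNeg => negb
  | NImp => implb
  | NEq a => fun v y => `[< v = y >]
  | NAll al => fun f => `[< forall v, f v >]
  | NVar a n => sval (cid (possible_var a n))
  end.

Lemma dassignment_logical : logical dassignment (id : dom dframe TO -> bool).
Proof.
split=> [||[] []|a u w|al f] //=; first by exists id.
- by split=> /asboolP.
- by split=> /asboolP.
Qed.

(** Otherwise the union of [X] and [Y] would be unconflicted, and maximality would make them
    equal. *)
Lemma discriminants_conflict al (X Y : dvalue (TS al)) : X <> Y ->
  exists u w, [/\ sval X u, sval Y w & E (tneq (TS al) u w) \/ E (tneq (TS al) w u)].
Proof.
move=> neqXY; apply: contrapT => h; apply: neqXY.
have [[hX1 hX2] maxX] := svalP X; have [[hY1 hY2] maxY] := svalP Y.
apply: dvalue_TS_ext => u Xu; apply: (maxY (fun w => sval X w \/ sval Y w)); last by left.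
  split=> [w [/hX1|/hY1]//|w w' [Xw|Yw] [Xw'|Yw'] Ew]; [exact: hX2 Ew| | |exact: hY2 Ew].
    by apply: h; exists w, w'; split=> //; left.
  by apply: h; exists w', w; split=> //; right.
by right.
Qed.

Lemma discriminating_normal al u : discriminating E al u -> norm u = u.
Proof.
case=> _ [t [|]] /EB[wE nE _]; have [wu wt] := wff_tneqE wE;
by move: nE; rewrite /normal norm_tneq // => -[].
Qed.

(** The singleton of [u] is unconflicted by [EFO_irrefl], so it extends to a discriminant. *)
Lemma discriminating_possible al u :
  discriminating E al u -> exists X : dvalue (TS al), sval X u.
Proof.
move=> du; have nu := discriminating_normal du; have [wu _] := du.
have [|Y hY uY] := @discriminant_ext al (eq^~ u).
  split=> [_ -> //|_ _ -> ->]; rewrite -{1 2}nu.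
  by apply: EFO_irrefl => //; apply: discriminating_EFO du.
by exists (exist _ Y hY); apply: uY.
Qed.


(** Equal values are a common possible value, which excludes a disequation. Distinct values contain
    conflicting terms, and (Con) would separate [s] or [t] from a member of its own discriminant. *)
Lemma possible_teq al : possible (N (NEq (TS al))) (dassignment (NEq (TS al))).
Proof.
move=> s X ws hs t Y wt ht /=.
have [XY|/discriminants_conflict[u [w [Xu Yw conflict]]]] := asboolP (X = Y).
  move=> Est; rewrite -XY {Y XY} in ht *.
  move: Est; rewrite (norm_teq ws wt).
  exact: possible_tneq ws wt hs ht.
rewrite (norm_teq ws wt) => Est.
have [[_ hX] _] := svalP X; have [[_ hY] _] := svalP Y.
case: conflict => Euw; have [[E1 E2]|[E1 E2]] := evident_Con Est Euw.
- exact: hX (hs (discriminatingl E1)) Xu E1.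
- exact: hY (ht (discriminatingl E2)) Yw E2.
- exact: hY (ht (discriminatingl E2)) Yw E2.
- exact: hX (hs (discriminatingl E1)) Xu E1.
Qed.

Lemma possible_tall al : possible (N (NAll al)) (dassignment (NAll al)).
Proof.
move=> s f ws hs /=; case: asboolP => [hf|nf]; rewrite norm_tall //.
(* The variable of (AllN) has a possible value, at which [f] is true; this excludes the negated
   instance. *)
- move=> /evident_AllN[n].
  have wn : wff (TS al) (N (NVar (TS al) n)) by [].
  have [v hv] := possible_var (TS al) n.
  rewrite (norm_app ws wn) => En.
  by have := hs _ _ wn hv; rewrite /= hf.
- move=> Es; apply: nf => X; apply: contrapT => /negP/negbTE fX.
  have [[u Xu]|X0] := EM (exists u, sval X u).
    have du : discriminating E al u := proj1 (proj1 (svalP X)) u Xu.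
    have wu := proj1 du.
    have := evident_All Es du; rewrite (norm_app ws wu).
    have := hs u X wu; rewrite /= fX; apply; by rewrite (discriminating_normal du).
  (* A discriminating term lies in some discriminant, and no discriminant
     properly contains the empty one; so if [X] is empty, every term is
     possibly [X], in particular the instance given by (All'). *)
  have [u [wu nu eu]] := evident_All' Es; rewrite (norm_app ws wu) => Esu.
  have := hs u X wu; rewrite /= fX; apply=> //.
  rewrite nu => du; have [Y Yu] := discriminating_possible du.
  apply: (proj2 (svalP X)) Yu; first exact: (proj1 (svalP Y)).
  by move=> w Xw; case: X0; exists w.
Qed.

Lemma possible_name x : efo_name x -> possible (N x) (dassignment x).
Proof.
case: x => [|||al|a n] //=; last by move=> _; case: cid.
- move=> _ s v ws; case: v => /= hs; rewrite norm_neg //.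
  by move=> /evident_DN.
- move=> _ s v ws hs t y wt ht.
  case: v y hs ht => [] [] /= hs ht; rewrite norm_imp //.
  + by move=> /evident_ImpN[].
  + by move=> /evident_Imp[].
  + by move=> /evident_ImpN[].
  + by move=> /evident_ImpN[].
- by case=> //= al _; exact: possible_teq.
- by move=> _; apply: possible_tall.
Qed.

(* [v] is chosen before [th]: in the abstraction case the substitution [th^x_t]
   depends on a term [t] possible for the argument, while the value does not. *)
Lemma possible_eval s a (I : assignment dframe) : wff a s -> EFO s ->
  exists2 v : dom dframe a, Ev I s (existT _ a v) &
    forall th, subst_ok th ->
      (forall x, efo_name x -> possible (subst th (N x)) (I x)) ->
    possible (subst th s) v.
Proof.
elim: s a I => [x|s IHs t IHt|x s IHs] a I ws es.
- case: ws => ea; subst a; exists (I x); first exact: EvN.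
  by move=> th _; apply; apply: EFO_name.
- have [b wfs wft] := wff_appE ws; have [es1 es2] := EFO_app es.
  have [f Ef hf] := IHs _ I wfs es1; have [v Ev' hv] := IHt _ I wft es2.
  exists (f v); first exact: EvApp Ef Ev'.
  move=> th hth hI; rewrite (subst_app hth ws); apply: hf => //.
    exact: wff_subst.
  exact: hv.
- have [b ea wb] := wff_lamE ws; subst a.
  have /choice[f hf] : forall v : dom dframe (nty x), exists y : dom dframe b,
      Ev (upd I x v) s (existT _ b y) /\ forall th, subst_ok th ->
      (forall z, efo_name z -> possible (subst th (N z)) (upd I x v z)) ->
      possible (subst th s) y.
    by move=> v; have [y] := IHs _ (upd I x v) wb (EFO_lam es); exists y.
  exists f; first by apply: EvLam => v; case: (hf v).
  move=> th hth hI t v wt ht; have ku := subst_ok_upd hth wt.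
  apply: (@possible_norm _ (subst (upd_sub th x t) s)).
  + exact: wff_subst.
  + by apply: wff_app wt; apply: wff_subst.
  + by rewrite (norm_subst_lam hth wb wt).
  apply: (proj2 (hf v)) => // y ey; rewrite subst_name // /upd_sub /upd.
  case: name_eq_dec => [exy|_] /=; first by subst y.
  by have := hI y ey; rewrite subst_name.
Qed.

Lemma possible_dassignment s a : wff a s -> EFO s ->
  exists2 v : dom dframe a, Ev dassignment s (existT _ a v) & possible s v.
Proof.
move=> ws es; have [v Ev' hv] := possible_eval dassignment ws es; exists v => //.
apply: (@possible_norm _ (subst (fun=> None) s)) => //.
- exact: (wff_subst subst_ok_id ws).
- exact: norm_subst_id ws.
apply: (hv _ subst_ok_id) => x ex; rewrite (subst_name _ subst_ok_id).
exact: possible_name.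
Qed.

Lemma dassignment_model : model dassignment E.
Proof.
exists id; split=> [|s Es]; first exact: dassignment_logical.
have [ws ns [es|[a [u [w [es [eu ew]]]]]]] := EB Es.
  have [[] Ev' /= hv] := possible_dassignment ws es; first by exists true.
  by case: hv; rewrite ns.
(* The equality may be at a type where it is not EFO, so the disequation is evaluated by hand; its
   sides differ, as a common possible value would keep it out of the branch. *)
subst s; have [wu ww] := wff_tneqE ws.
have [v Ev' hv] := possible_dassignment wu eu.
have [y Ey hy] := possible_dassignment ww ew.
exists (~~ `[< v = y >]); split.
  apply: (@EvApp _ dframe _ _ _ TO TO negb); first exact: (EvN dassignment NNeg).
  apply: (@EvApp _ dframe _ _ _ a TO (fun y => `[< v = y >])) Ey.
  apply: (@EvApp _ dframe _ _ _ a (TArr a TO) (fun v y => `[< v = y >])) Ev'.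
  exact: (EvN dassignment (NEq a)).
apply/asboolPn => vy; subst y.
by have := possible_tneq wu ww hv hy; rewrite -norm_tneq // ns.
Qed.

(** For conflicting [s] in [X] and [t] in [Y], completeness decides [s = u]. The negation
    contradicts [X]; from the equation, (Con) separates [s] from itself, against [X], or [u] from
    [t], against [Y]. *)
Lemma complete_discriminant_eq al (X Y : dvalue (TS al)) u :
  efo_complete norm E -> sval X u -> sval Y u -> X = Y.
Proof.
move=> cE Xu Yu; apply: contrapT => /discriminants_conflict[s [t [Xs Yt conflict]]].
have [[dX hX] _] := svalP X; have [[_ hY] _] := svalP Y.
have [[wu _] [ws _]] := (dX _ Xu, dX _ Xs).
have [] := cE (teq (TS al) s u).
- exact: wff_teq.
- rewrite /normal norm_teq //.
  by rewrite (discriminating_normal (dX _ Xs)) (discriminating_normal (dX _ Xu)).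
- apply: EFO_teq; first exact: discriminating_EFO (dX _ Xs).
  exact: discriminating_EFO (dX _ Xu).
- move=> Esu; case: conflict => Est; have [[E1 E2]|[E1 E2]] := evident_Con Esu Est.
  + exact: (hX _ _ Xs Xs).
  + exact: hY Yu Yt E2.
  + exact: hY Yu Yt E2.
  + exact: (hX _ _ Xs Xs).
- exact: hX.
Qed.
End EvidentBranch.

(** * Countability of terms and discriminants *)

Section Countability.
Context (S : countType).

(** Constructors are told apart by the length of the pickled list; the zeros in the codes below are
    padding. *)
Fixpoint ty_code (a : ty S) : nat :=
  match a with
  | TO => pickle ([::] : seq nat)
  | TS al => pickle [:: pickle al]
  | TArr a b => pickle [:: ty_code a; ty_code b]
  end.

Definition name_code (x : name S) : nat :=
  match x with
  | NNeg => pickle ([::] : seq nat)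
  | NImp => pickle [:: 0]
  | NEq a => pickle [:: 0; ty_code a]
  | NAll al => pickle [:: 0; 0; pickle al]
  | NVar a n => pickle [:: 0; 0; ty_code a; n]
  end.

Fixpoint tm_code (s : tm S) : nat :=
  match s with
  | N x => pickle [:: name_code x]
  | App s t => pickle [:: tm_code s; tm_code t]
  | Lam x s => pickle [:: 0; name_code x; tm_code s]
  end.

Let pickle_inj (T : countType) : injective (@pickle T) := pcan_inj pickleK.

Lemma ty_code_inj : injective ty_code.
Proof.
elim=> [|al|a IHa b IHb] [|be|c d] //= /pickle_inj; try by case.
- by move=> [/pickle_inj ->].
- by move=> [/IHa -> /IHb ->].
Qed.

Lemma name_code_inj : injective name_code.
Proof.
case=> [||a|al|a n] [||b|be|b m] //= /pickle_inj; try by case.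
- by move=> [/ty_code_inj ->].
- by move=> [/pickle_inj ->].
- by move=> [/ty_code_inj -> ->].
Qed.

Lemma tm_code_inj : injective tm_code.
Proof.
elim=> [x|s IHs t IHt|x s IHs] [y|s' t'|y s'] //= /pickle_inj; try by case.
- by move=> [/name_code_inj ->].
- by move=> [/IHs -> /IHt ->].
- by move=> [/name_code_inj -> /IHs ->].
Qed.

End Countability.

Lemma complete_countable (S : countType) (norm : tm S -> tm S)
    (subst : (name S -> option (tm S)) -> tm S -> tm S) (E : tm S -> Prop) al :
  normalization_ok norm subst -> efo_branch norm E -> evident norm E ->
  efo_complete norm E -> countable_type (dvalue E (TS al)).
Proof.
move=> ns EB EE cE.
(* Code 0 is reserved for the empty discriminant, whence the successor for a chosen member of a
   nonempty one. *)
exists (fun X => if pselect (exists u, sval X u) is left h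
                 then (tm_code (sval (cid h))).+1 else 0).
move=> X Y; case: pselect => [hX|nX]; case: pselect => [hY|nY] //.
  case: cid => u Xu; case: cid => w Yw /= [/tm_code_inj uw]; subst w.
  exact: (complete_discriminant_eq ns EB EE cE Xu Yw).
by move=> _; apply: dvalue_TS_ext => u Xu; case: nX; exists u.
Qed.

(** * Finiteness *)

Fixpoint words (B : Type) (lb : list B) (n : nat) : list (list B) :=
  if n is n'.+1 then
    List.flat_map (fun b => List.map (cons b) (words lb n')) lb
  else [:: [::]].

Lemma in_words (A B : Type) (f : A -> B) (la : list A) (lb : list B) :
  (forall b, List.In b lb) -> List.In (List.map f la) (words lb (List.length la)).
Proof.
move=> hb; elim: la => [|x la IH] /=; first by left.
by apply/List.in_flat_map; exists (f x); split=> //; apply: List.in_map.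
Qed.

Lemma finite_type_inj (T A : Type) (f : T -> A) (l : list A) :
  injective f -> (forall x, List.In (f x) l) -> finite_type T.
Proof.
move=> f_inj fl.
exists (List.flat_map (fun y =>
  if pselect (exists x, f x = y) is left h then [:: sval (cid h)] else [::]) l).
move=> x; apply/List.in_flat_map; exists (f x); split=> //.
case: pselect => [h|]; last by case; exists x.
by left; case: cid => y /= /f_inj.
Qed.

(** Elements embed into the finitely many words of their values along [la]. This serves sorts,
    through membership bits, and function types. *)
Lemma finite_type_ext (T A B : Type) (F : T -> A -> B) (la : list A) (lb : list B) :
    (forall b, List.In b lb) ->
    (forall x y, (forall a, List.In a la -> F x a = F y a) -> x = y) ->
  finite_type T.
Proof.
move=> hb Fext.
apply: (@finite_type_inj _ _ (fun x => List.map (F x) la) (words lb (List.length la))).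
  by move=> x y /List.ext_in_map/Fext.
by move=> x; apply: in_words.
Qed.

(** Heads are not checked: extra entries do no harm as long as all sides of disequations are
    covered. *)
Definition diseq_sides (S : Type) (s : tm S) : list (tm S) :=
  if s is App _ (App (App _ u) w) then [:: u; w] else [::].

Lemma finite_dvalue (S : countType) (E : tm S -> Prop) (a : ty S) :
  finite_set E -> finite_type (dvalue E a).
Proof.
move=> [l El]; have bool_all (p : bool) : List.In p [:: true; false].
  by case: p => /=; [left|right; left].
elim: a => [|al|a [la ha] b [lb hb]] /=; first by exists [:: true; false].
(* All members of a discriminant are sides of disequations, so membership bits on those sides
   determine it. *)
- apply: (@finite_type_ext _ _ _ (fun X : dvalue E (TS al) => fun u => `[< sval X u >])
    (List.flat_map (@diseq_sides S) l) _ bool_all) => X Y XY.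
  apply: dvalue_TS_ext => u Xu.
  suff /XY h : List.In u (List.flat_map (@diseq_sides S) l).
    by apply/asboolP; rewrite -h; apply/asboolP.
  have [_ [t Et]] := proj1 (proj1 (svalP X)) u Xu.
  apply/List.in_flat_map.
  by case: Et => /El h; eexists; split; try exact: h => /=; [left|right; left].
- apply: (@finite_type_ext _ _ _ (fun f : dvalue E a -> dvalue E b => f) la lb hb) => f g fg.
  by apply/funext => v; apply/fg/ha.
Qed.

Theorem theorem13p9 (S : countType) (norm : tm S -> tm S)
  (subst : (name S -> option (tm S)) -> tm S -> tm S) :
  normalization_ok norm subst ->
  [/\ (forall E : tm S -> Prop, efo_branch norm E -> evident norm E ->
         exists (F : frame S) (I : assignment F), standard F /\ model I E),
      (forall E : tm S -> Prop, efo_branch norm E -> evident norm E -> efo_complete norm E ->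
         exists (F : frame S) (I : assignment F),
           [/\ standard F, model I E & forall a : S, countable_type (dom F (TS a))])
    & (forall E : tm S -> Prop, efo_branch norm E -> evident norm E -> finite_set E ->
         exists (F : frame S) (I : assignment F),
           [/\ standard F, model I E & forall a : ty S, finite_type (dom F a)])].
Proof.
move=> ns; split=> E EB EE.
- exists (dframe E), (dassignment ns EB EE).
  by split; [exact: dframe_standard|exact: dassignment_model].
- move=> cE; exists (dframe E), (dassignment ns EB EE).
  split; [exact: dframe_standard|exact: dassignment_model|move=> al].
  exact: complete_countable ns EB EE cE.
- move=> fE; exists (dframe E), (dassignment ns EB EE).
  split; [exact: dframe_standard|exact: dassignment_model|move=> a].
  exact: finite_dvalue.
Qed.
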